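(* If $q\ge3$ is an odd prime power, then $$p(\mathrm{GL}_2(\mathbb{F}_q))=p(\mathrm{SL}_2(\mathbb{F}_q))+T_{2,q}(q-1)=(q+1)\,(q-1)_2+T_{2,q}(q-1).$$
   Context: For a finite group $G$, $p(G)$ is the smallest natural number $m$ such that the symmetric group $S_m$ has a subgroup isomorphic to $G$ (the size of the smallest set on which $G$ acts faithfully). For a natural number $N=2^r\prod_{\ell\text{ odd prime}}\ell^{e_\ell}$, set $N_2=2^r$ and $T_{2,q}(N)=\sum_{\ell\text{ odd prime},\ e_\ell\ge1}\ell^{e_\ell}$ (an empty sum is $0$). *)

(* Defs.v *)
From mathcomp Require Import all_boot all_order all_fingroup all_algebra.

Set Implicit Arguments.
Unset Strict Implicit.
Unset Printing Implicit Defensive.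

Import GroupScope GRing.Theory.

Definition embeds_in_Sym (gT : finGroupType) (G : {group gT}) (m : nat) : bool :=
  [exists H : {group 'S_m}, G \isog H].

Section TransportPerm.
Variable T : finType.

Definition ord_perm_fun (s : {perm T}) (i : 'I_#|T|) : 'I_#|T| :=
  enum_rank (s (enum_val i)).

Lemma ord_perm_inj (s : {perm T}) : injective (ord_perm_fun s).
Proof. by move=> i j /enum_rank_inj/perm_inj/enum_val_inj. Qed.

Definition ord_perm (s : {perm T}) : 'S_#|T| := perm (@ord_perm_inj s).

Lemma ord_permM : {in setT &, {morph ord_perm : s t / s * t}}.
Proof.
move=> s t _ _; apply/permP=> i.
by rewrite permM !permE /ord_perm_fun enum_rankK permM.
Qed.

Canonical ord_perm_morphism := Morphism ord_permM.

Lemma ord_perm_injm : 'injm ord_perm.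
Proof.
apply/injmP=> s t _ _ /permP eq_st; apply/permP=> x.
by have:= eq_st (enum_rank x); rewrite !permE /ord_perm_fun enum_rankK => /enum_rank_inj.
Qed.

End TransportPerm.

Lemma embeds_in_Sym_ex (gT : finGroupType) (G : {group gT}) :
  exists m, embeds_in_Sym G m.
Proof.
exists #|gT|; apply/existsP.
exists (ord_perm_morphism gT @* (Cayley_repr G @* G))%G.
apply: isog_trans (Cayley_isog G) _.
exact: sub_isog (subsetT _) (ord_perm_injm gT).
Qed.

Definition min_perm_degree (gT : finGroupType) (G : {group gT}) : nat :=
  ex_minn (embeds_in_Sym_ex G).

Definition SLgroup (n : nat) (F : finFieldType) : {set {'GL_n[F]}} :=
  [set u : {'GL_n[F]} | (\det (GLval u) == 1)%R].

Lemma SLgroup_group_set (n : nat) (F : finFieldType) : group_set (SLgroup n F).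
Proof.
apply/group_setP; split=> [|u v]; first by rewrite inE GL_1E det1.
by rewrite !inE GL_MxE det_mulmx => /eqP-> /eqP->; rewrite mulr1.
Qed.

Canonical SLgroup_group (n : nat) (F : finFieldType) : {group {'GL_n[F]}} :=
  Group (SLgroup_group_set n F).

Definition prime_power (q : nat) : Prop :=
  exists p k : nat, [/\ prime p, 0 < k & q = p ^ k]%N.

Definition T2 (N : nat) : nat :=
  (\sum_(l <- primes N | odd l) l ^ logn l N)%N.

(* Main.v *)
Require Import Defs.
From mathcomp Require Import all_boot all_order all_fingroup all_algebra.
From mathcomp Require Import all_solvable all_field ring zify.

(** Lower bound for SL_2(q): -1 is the only involution, so a point not fixed
    by -1 has an odd order stabiliser H, and H acts on the q + 1 (an even
    number) points of the projective line with at least two orbits, all of odd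
    size. A p-element fixes exactly one line, so by Sylow's theorem the lines
    fixed by some nontrivial p-element of H form at most one orbit; hence some
    line has a p'-stabiliser in H, of order at most (q - 1)_{2'}, and an orbit
    of size at most q. Thus |H| <= q (q - 1)_{2'}.

    For GL_2(q), let H be the stabiliser of a point and P the subgroup of the
    scalars generated by the Sylow l-subgroups, for all odd l such that H
    contains no scalar of order l. Then |GL : H| = |GL : HP| |P|, and the bound
    above applies to HP if -1 is not in H. As a product of integers greater
    than 1 dominates their sum, each orbit is large enough to account for all
    the primes l for which it is moved by the scalars of order l.

    Conversely, GL_2(q) acts on the nonzero vectors up to scalars of odd order,
    and through the determinant on F^x / O_{l'}(F^x) for each odd l. *)

Set Implicit Arguments.
Unset Strict Implicit.
Unset Printing Implicit Defensive.

Import GroupScope GRing.Theory.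

(** * Permutation degrees and subgroup indices in abstract finite groups *)

Lemma min_perm_degree_le (gT : finGroupType) (G : {group gT}) m n :
  embeds_in_Sym G m -> m <= n -> min_perm_degree G <= n.
Proof.
move=> Gm; apply: leq_trans.
by rewrite /min_perm_degree; case: ex_minnP => k _; apply.
Qed.

Lemma min_perm_degreeP (gT : finGroupType) (G : {group gT}) :
  embeds_in_Sym G (min_perm_degree G).
Proof. by rewrite /min_perm_degree; case: ex_minnP. Qed.

(** [G] acts by right translation on the disjoint union of the coset spaces; the kernel is the
    intersection of all [G]-conjugates of the [H i], trivial by hypothesis. *)
Lemma embeds_sum_index (gT : finGroupType) (G : {group gT}) (I : finType)
    (H : I -> {group gT}) :
    (forall x, x \in G -> (forall i g, g \in G -> x \in H i :^ g) -> x = 1) ->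
  embeds_in_Sym G (\sum_i #|G : H i|).
Proof.
move=> core1.
pose P := [pred u : I * {set gT} | u.2 \in rcosets (H u.1) G].
(* Total on pairs of an index and an arbitrary set; the action on true cosets is the one induced on
   the subtype [T] below. *)
pose to (u : I * {set gT}) g := (u.1, u.2 :* g).
have to1: to^~ 1 =1 id by case=> i A; rewrite /to /= rcoset1.
have toM u : act_morph to u by move=> g h; rewrite /to /= rcosetM.
pose act := TotalAction to1 toM.
pose T := {u : I * {set gT} | P u}.
have sGD : G \subset subact_dom P act.
  apply/subsetP=> g Gg; rewrite !inE /=; apply/subsetP=> -[i A] /[!inE] /=.
  case/rcosetsP=> h Gh ->; rewrite -rcosetM mem_rcosets.
  by rewrite (subsetP (mulG_subr _ _)) ?groupM.
have cardT : #|{: T}| = (\sum_i #|G : H i|)%N.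
  rewrite card_sig -sum1_card.
  rewrite (eq_bigl (fun u => true && (u.2 \in rcosets (H u.1) G))) //.
  rewrite -(pair_big_dep xpredT (fun i A => A \in rcosets (H i) G)
                         (fun _ _ => 1%N)) /=.
  by apply: eq_bigr => i _; rewrite sum1_card.
rewrite -cardT.
pose phi := actperm_morphism (act^? : action _ T).
have inj_phi : 'injm (restrm sGD phi).
  rewrite ker_restrm ker_actperm; apply/subsetP=> x /setIP[Gx Cx]; rewrite inE.
  apply/eqP/core1=> // i g Gg; rewrite mem_conjg.
  have Pu : P (i, H i :* g) by rewrite /= mem_rcosets (subsetP (mulG_subr _ _)).
  have:= astab_act Cx (in_setT (Sub _ Pu : T)).
  move/(congr1 val); rewrite val_subact (subsetP sGD) //= => -[] eqHg.
  have: g * x \in H i :* g by rewrite -eqHg -rcosetM rcoset_refl.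
  by rewrite mem_rcoset conjgE invgK mulgA.
have injo := ord_perm_injm T.
apply/existsP; exists (ord_perm_morphism T @* (restrm sGD phi @* G))%G.
by apply: isog_trans (sub_isog _ inj_phi) (sub_isog _ injo); rewrite ?subsetT.
Qed.

(** A central element that moves one point of an orbit moves all of them, so it lies in no point
    stabiliser there. Each orbit thus pays for all the [j] with [z j] moving it, and every [j] is
    paid for, since [z j] is nontrivial and moves some point. *)
Lemma sum_weights_le_degree (gT : finGroupType) (G : {group gT}) n (J : eqType)
    (r : seq J) (z : J -> gT) (w : J -> nat) :
    embeds_in_Sym G n ->
    {in r, forall j, z j \in 'Z(G) /\ z j != 1} ->
    (forall H : {group gT}, H \subset G ->
      \sum_(j <- r | z j \notin H) w j <= #|G : H|) ->
  \sum_(j <- r) w j <= n.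
Proof.
case/existsP=> H0 /isogP[f injf defH0] Zz leG.
have acts_f : [acts f @* G, on [set: 'I_n] | 'P].
  by apply/subsetP=> a _; rewrite !inE; apply/subsetP=> x _; rewrite !inE.
pose moved (T : {set 'I_n}) j := [exists x in T, f (z j) x != x].
have card_T: {in orbit 'P (f @* G) @: setT, forall T,
    \sum_(j <- r | moved T j) w j <= #|T|}.
  move=> _ /imsetP[x _ ->].
  have -> : #|orbit 'P (f @* G) x| = #|G : f @*^-1 'C_(f @* G)[x | 'P]|.
    rewrite card_orbit -{3}(morphim_invm injf (subxx G)).
    have <- : invm injf @* 'C_(f @* G)[x | 'P] = f @*^-1 'C_(f @* G)[x | 'P].
      by rewrite morphim_invmE.
    by rewrite index_injm ?injm_invm ?subsetIl.
  have sKG : f @*^-1 'C_(f @* G)[x | 'P] \subset G by apply: subsetIl.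
  apply: leq_trans (leG _ sKG).
  rewrite big_seq_cond [X in _ <= X]big_seq_cond.
  apply: sub_le_big => //=; first by move=> *; apply: leq_addr.
  move=> j /andP[rj]; rewrite rj /= => /exists_inP[y /orbitP[a fa <-]].
  apply: contra => /morphpreP[Gz /setIP[_ /astab1P]]; rewrite /= apermE => fx.
  have [g _ Gg defa] := morphimP fa.
  have [/centerP[_ cz] _] := Zz j rj.
  by rewrite apermE -permM defa -morphM // -cz // morphM // permM fx.
rewrite -[X in _ <= X]card_ord -cardsT -(acts_sum_card_orbit acts_f).
apply: (@leq_trans (\sum_(T in orbit 'P (f @* G) @: setT)
                       \sum_(j <- r | moved T j) w j)); last first.
  exact: leq_sum card_T.
(* After the exchange of sums, it is enough that each [j] occurs for at least one orbit. *)
rewrite (exchange_big_dep xpredT) //= big_seq [X in _ <= X]big_seq.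
apply: leq_sum => j rj.
have [/centerP[Gz cz] nz] := Zz j rj.
have [x fx]: exists x, f (z j) x != x.
  apply/existsP; apply: contraR nz => /existsPn fz.
  have/eqP: f (z j) = 1.
    by apply/permP=> x; rewrite perm1; apply/eqP; move/(_ x): fz => /negPn.
  by rewrite (morph_injm_eq1 injf).
rewrite (bigD1 (orbit 'P (f @* G) x)) ?leq_addr //=.
rewrite imset_f ?inE //=; apply/exists_inP.
by exists x => //; apply: orbit_refl.
Qed.

(* For H acting on the right cosets of B, c is the order of a p'-stabiliser. *)
Lemma odd_subgroup_bound (gT : finGroupType) (G B H : {group gT}) (p : nat) :
    B \subset G -> H \subset G -> ~~ odd #|G : B| -> odd #|H| -> prime p ->
    (forall u g, u \in B -> u \in B :^ g -> p.-elt u -> u != 1 -> g \in G ->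
      g \in B) ->
  exists c, [/\ c %| #|B|, ~~ (p %| c), odd c & #|H| <= #|G : B|.-1 * c].
Proof.
move=> sBG sHG evGB oddH p_pr TI0.
(* The last hypothesis in terms of the action: a nontrivial [p]-element fixes at most one coset of
   [B]. *)
have TI u x y : u \in B :^ x -> u \in B :^ y -> p.-elt u -> u != 1 ->
    x \in G -> y \in G -> B :* x = B :* y.
  rewrite mem_conjg => Bu1 Bu2 pu ntu Gx Gy.
  apply/esym/rcoset_eqP; rewrite mem_rcoset.
  apply: (TI0 (u ^ x^-1)); rewrite ?p_eltJ ?conjg_eq1 //.
    by rewrite conjsgM memJ_conjg.
  by rewrite groupM ?groupV.
have stabE x : 'C_H[B :* x | 'Rs] = H :&: B :^ x.
  by have:= astab1_act 'Rs (B : {set gT}) x; rewrite /= astab1Rs rcosetE => ->.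
have sOS x : x \in G -> orbit 'Rs H (B :* x) \subset rcosets B G.
  move=> Gx; apply/subsetP=> _ /orbitP[h Hh <-] /=.
  rewrite rcosetE -rcosetM mem_rcosets (subsetP (mulG_subr _ _)) ?groupM //.
  exact: (subsetP sHG).
have oddO x : odd #|orbit 'Rs H (B :* x)|.
  by apply: dvdn_odd oddH; apply: dvdn_orbit.
have [/exists_inP[x Gx p'Hx]|] :=
    boolP [exists x in G, ~~ (p %| #|H :&: B :^ x|)].
  exists #|H :&: B :^ x|; split=> //.
  - by rewrite -(cardJg B x) cardSg ?subsetIr.
  - by apply: dvdn_odd oddH; rewrite cardSg ?subsetIl.
  rewrite -(card_orbit_stab 'Rs H (B :* x)) stabE leq_mul2r; apply/orP; right.
  (* An odd orbit is not the whole coset space, which has even size; hence the predecessor of the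
     index. *)
  rewrite -ltnS prednK ?indexg_gt0 // ltn_neqAle subset_leq_card ?sOS // andbT.
  by apply: contra evGB => /eqP <-.
(* Now every point stabiliser in [H] contains an element of order [p]; this makes [H] transitive, so
   the number of cosets would be odd. *)
move/exists_inPn => pH; case/negP: evGB.
suff defO : orbit 'Rs H (B :* 1) = rcosets B G by rewrite /indexg -defO.
apply/eqP; rewrite eqEsubset sOS //=; apply/subsetP=> _ /rcosetsP[x2 Gx2 ->].
have ex_u x : x \in G -> exists P : {group gT},
    p.-Sylow(H) P /\ exists2 u, u \in P :&: B :^ x & u != 1.
  move=> Gx; have /negPn := pH x Gx.
  case/(Cauchy p_pr) => u /setIP[Hu Bu] ou.
  have [| |P sylP sUP] := @Sylow_superset p _ H <[u]>; rewrite ?cycle_subG //.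
    by rewrite /pgroup -orderE ou pnat_id.
  exists P; split=> //; exists u; first by rewrite inE Bu -cycle_subG sUP.
  by rewrite -order_eq1 ou; case: (p) p_pr => [|[]].
have [P1 [sylP1 [u1 /setIP[P1u1 Bu1] ntu1]]] := ex_u 1 (group1 G).
have [P2 [sylP2 [u2 /setIP[P2u2 Bu2] ntu2]]] := ex_u x2 Gx2.
have [h Hh defP2] := Sylow_trans sylP1 sylP2.
have Gh := subsetP sHG h Hh.
have pP2 := pHall_pgroup sylP2.
(* A central [c] of [P2] permutes the cosets fixed by any [u] in [P2]. When [u] is nontrivial there
   is at most one, so [c] fixes it too; hence all nontrivial elements of [P2] that fix a coset fix
   the same one. *)
have [c Zc ntc] : exists2 c, c \in 'Z(P2) & c != 1.
  apply/trivgPn; apply: contra ntu2 => /eqP /(trivg_center_pgroup pP2) P21.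
  by rewrite P21 inE in P2u2.
have /centerP[P2c cPc] := Zc.
have Gc : c \in G by rewrite (subsetP sHG) // (subsetP (pHall_sub sylP2)).
have fix_c u x : u \in P2 -> u != 1 -> u \in B :^ x -> x \in G -> c \in B :^ x.
  move=> P2u ntu Bu Gx.
  have eqB : B :* x = B :* (x * c).
    apply: (TI u); rewrite ?groupM //; last exact: mem_p_elt P2u.
    by rewrite conjsgM -[u](_ : u ^ c = u) ?memJ_conjg // conjgE -cPc // mulKg.
  have: x * c \in B :* x by rewrite eqB rcoset_refl.
  by rewrite mem_rcoset mem_conjg conjgE invgK mulgA.
have ->: B :* x2 = B :* (1 * h).
  apply: (TI c); rewrite ?mul1g //.
  - exact: fix_c Bu2 _.
  - apply: (fix_c (u1 ^ h)); rewrite ?conjg_eq1 //.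
      by rewrite defP2 memJ_conjg.
    by rewrite memJ_conjg -(conjsg1 B).
  - exact: mem_p_elt P2c.
by rewrite rcosetM -(rcosetE (B :* 1)) (mem_orbit 'Rs).
Qed.

(** [K] is the product of [H] with the Hall [pi]-subgroup [P] of [Z], which meets [H] trivially
    because [H :&: Z] is a [pi']-group. *)
Lemma index_mul_central_Hall (gT : finGroupType) (G Z H : {group gT}) pi :
    Z \subset 'Z(G) -> H \subset G -> pi^'.-group (H :&: Z) ->
  exists K : {group gT}, #|G : H| = (#|G : K| * #|Z|`_pi)%N /\
    {in K, forall z, pi^'.-elt z -> z \in H}.
Proof.
move=> sZ sHG pi'HZ.
have [P hallP] : exists P : {group gT}, pi.-Hall(Z) P.
  exact/Hall_exists/abelian_sol/(abelianS sZ (center_abelian G)).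
have [sPZ piP _] := and3P hallP.
have sPcG := subset_trans sPZ sZ.
have sPG : P \subset G := subset_trans sPcG (center_sub G).
have cHP : P \subset 'C(H).
  by rewrite (subset_trans sPcG) // subIset // orbC centS.
have tiHP : H :&: P = 1.
  rewrite -(setIidPr sPZ) setIA; apply: coprime_TIg.
  by rewrite coprime_sym (pnat_coprime piP).
have defK : H <*> P = H * P by rewrite cent_joinEr.
exists (H <*> P)%G; split=> [|z /=].
  have sK : H <*> P \subset G by rewrite join_subG sHG.
  have cardK : #|H <*> P| = (#|H| * #|Z|`_pi)%N.
    by rewrite defK TI_cardMg // (card_Hall hallP).
  apply/eqP; rewrite -(eqn_pmul2l (cardG_gt0 H)) Lagrange // -(Lagrange sK) /=.
  by rewrite cardK mulnAC mulnA.
rewrite defK.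
case/mulsgP=> h a Hh Pa -> pi'z.
(* Raising to the power [#|P|] kills [a], and the result still generates [<[h * a]>], whose order is
   prime to [#|P|]. *)
have: (h * a) ^+ #|P| \in H.
  rewrite expgMn ?(expg_cardG Pa) ?mulg1 ?groupX //.
  by apply/esym; apply: (centP (subsetP cHP a Pa)).
apply: contraLR; rewrite -!cycle_subG; apply: contra.
have /eqP<- : generator <[h * a]> ((h * a) ^+ #|P|); last by [].
by rewrite generator_coprime coprime_sym (pnat_coprime piP).
Qed.

(** * Arithmetic of prime factors, and small auxiliary facts *)

Lemma sum_le_prod (I : Type) (r : seq I) (P : pred I) (w : I -> nat) :
  (forall i, P i -> 1 < w i) ->
  \sum_(i <- r | P i) w i <= \prod_(i <- r | P i) w i.
Proof.
move=> w_gt1.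
set S := (\sum_(i <- r | _) _)%N; set T := (\prod_(i <- r | _) _)%N.
(* The empty family is kept apart: the induction uses [a + b <= a * b], which needs both terms to
   exceed 1. *)
suff: (S = 0 /\ T = 1 \/ S <= T /\ 1 < T)%N by case=> [[-> ->] | []].
rewrite {}/S {}/T; elim: r => [|i r]; first by rewrite !big_nil; left.
rewrite !big_cons; case: ifP => // /w_gt1 w1 [[-> ->] | [leST T1]]; right; nia.
Qed.

Lemma partn_prod_primes (pi : nat_pred) n : 0 < n ->
  (n`_pi)%N = (\prod_(l <- primes n | l \in pi) l ^ logn l n)%N.
Proof.
move=> n_gt0; rewrite /partn (bigID (mem (primes n))) /=.
rewrite [X in (_ * X)%N]big1 ?muln1.
  rewrite -big_filter -[RHS]big_filter; apply: perm_big.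
  apply: uniq_perm; rewrite ?filter_uniq ?primes_uniq ?iota_uniq // => l.
  rewrite !mem_filter mem_index_iota /= -andbA; congr andb.
  case: (boolP (l \in primes n)) => //; rewrite mem_primes => /and3P[_ _].
  by move/(dvdn_leq n_gt0); rewrite ltnS => ->.
by move=> l /andP[_]; rewrite -logn_gt0 lt0n negbK => /eqP->; rewrite expn0.
Qed.

Lemma big_even_primes (R : Type) (idx : R) (op : Monoid.com_law idx) n
    (P : pred nat) (f : nat -> R) : 0 < n -> ~~ odd n ->
  \big[op/idx]_(l <- primes n | P l && ~~ odd l) f l = if P 2 then f 2 else idx.
Proof.
move=> n_gt0 even_n.
have n2 : 2 \in primes n by rewrite mem_primes n_gt0 dvdn2.
have evenP l : l \in primes n -> ~~ odd l = (l == 2).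
  rewrite mem_primes => /andP[/even_prime[->|odd_l] _] //.
  by rewrite odd_l; case: eqP odd_l => // ->.
rewrite big_mkcondl -big_filter (eq_in_filter evenP).
by rewrite filter_pred1_uniq ?primes_uniq // big_seq1.
Qed.

(** Conjugacy as an equation without inverses, to be compared entry by entry for matrices. *)
Lemma mem_conjg_witness (gT : finGroupType) (A : {set gT}) u g :
  u \in A :^ g -> exists2 v, v \in A & g * u = v * g.
Proof. by rewrite mem_conjg => Av; exists (u ^ g^-1); rewrite // -conjgCV. Qed.

Lemma mulg_order2 (gT : finGroupType) (x : gT) : #[x] = 2 -> x * x = 1.
Proof. by move=> ox; rewrite -expg2 -ox expg_order. Qed.

Lemma ord2_cases (i : 'I_2) : i = 0%R \/ i = 1%R.
Proof. by case: i => [[|[|//]] ?]; [left | right]; apply: val_inj. Qed.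

(** * Scalars, determinant and triangular matrices in [GL_2(F)] *)

Section GL2.
Variable F : finFieldType.
Implicit Types (u v : {'GL_2[F]}) (a b c d : F).

Lemma det_mx2 (A : 'M[F]_2) : (\det A = A 0 0 * A 1 1 - A 0 1 * A 1 0)%R.
Proof.
rewrite (expand_det_row _ 0%R) !big_ord_recl big_ord0 addr0 /cofactor.
rewrite !det_mx11 !mxE /= expr0 mul1r expr1 mulN1r mulrN.
by congr (_ * A _ _ - A _ _ * A _ _)%R; apply: val_inj.
Qed.

Definition mx u : 'M[F]_2 := GLval u.

Lemma mx_inj : injective mx. Proof. exact: val_inj. Qed.

Lemma mx1 : mx 1%g = 1%:M%R. Proof. by []. Qed.

Lemma mxM u v : mx (u * v)%g = (mx u *m mx v)%R. Proof. by []. Qed.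

Lemma GL2_ext u v :
  mx u 0%R 0%R = mx v 0%R 0%R -> mx u 0%R 1%R = mx v 0%R 1%R ->
  mx u 1%R 0%R = mx v 1%R 0%R -> mx u 1%R 1%R = mx v 1%R 1%R -> u = v.
Proof.
move=> e00 e01 e10 e11; apply: mx_inj; apply/matrixP.
by move=> i j; case: (ord2_cases i) => ->; case: (ord2_cases j) => ->.
Qed.

Lemma GL2_mulE u v (i j : 'I_2) :
  (mx (u * v)%g i j = mx u i 0 * mx v 0 j + mx u i 1 * mx v 1 j)%R.
Proof.
rewrite mxM mxE !big_ord_recl big_ord0 addr0.
by congr (_ + mx u _ _ * mx v _ _)%R; apply: val_inj.
Qed.

Lemma GL2_det u : (mx u 0 0 * mx u 1 1 - mx u 0 1 * mx u 1 0 != 0)%R.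
Proof. by rewrite -det_mx2; exact: (GL_det u). Qed.

Definition mat2 a b c d : 'M[F]_2 :=
  (\matrix_(i, j) if i == 0 then if j == 0 then a else b
                  else if j == 0 then c else d)%R.

(* The default value 1 is taken when the matrix is singular. *)
Definition gl2 a b c d : {'GL_2[F]} := insubd (1%g : {'GL_2[F]}) (mat2 a b c d).

Lemma gl2E a b c d : (a * d - b * c != 0)%R ->
  [/\ mx (gl2 a b c d) 0%R 0%R = a, mx (gl2 a b c d) 0%R 1%R = b,
      mx (gl2 a b c d) 1%R 0%R = c & mx (gl2 a b c d) 1%R 1%R = d].
Proof.
move=> nz; have -> : mx (gl2 a b c d) = mat2 a b c d.
  apply: (insubdK (1%g : {'GL_2[F]})).
  by rewrite unfold_in /= -/(_ \in unitmx) unitmxE det_mx2 !mxE /= unitfE.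
by rewrite !mxE.
Qed.

(** The lower left entry is free. The relation [P] on the diagonal lets one count serve both the
    triangular matrices of determinant 1 and the stabiliser used for the upper bound. *)
Lemma card_lower_triangular (P : rel F) :
  #|[set u : {'GL_2[F]} |
      (mx u 0%R 1%R == 0%R) && P (mx u 0%R 0%R) (mx u 1%R 1%R)]| =
  (#|F| * #|[set x : F * F | [&& x.1 != 0%R, x.2 != 0%R & P x.1 x.2]]|)%N.
Proof.
rewrite -cardsT -cardsX; set L := [set u | _]; set X := setX _ _.
pose f u := (mx u 1%R 0%R, (mx u 0%R 0%R, mx u 1%R 1%R)).
have <- : f @: L = X.
  apply/setP=> -[c [a d]]; rewrite !inE /=; apply/imsetP/idP=> [[u]|].
    rewrite inE => /andP[/eqP u01 Pu] [_ -> ->]; have:= GL2_det u.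
    by rewrite u01 mul0r subr0 mulf_eq0 negb_or Pu andbT.
  case/and3P=> nza nzd Pad; have [|e00 e01 e10 e11] := @gl2E a 0%R c d.
    by rewrite mul0r subr0 mulf_neq0.
  by exists (gl2 a 0 c d)%R; rewrite /f ?inE e00 ?e01 ?e10 e11 ?eqxx.
rewrite card_in_imset // => u v.
rewrite !inE => /andP[/eqP u0 _] /andP[/eqP v0 _] [].
by move=> e1 e0 e2; apply: GL2_ext; rewrite ?u0.
Qed.

Definition scalars := [set u : {'GL_2[F]} | is_scalar_mx (mx u)].

Lemma scalars_group_set : group_set scalars.
Proof.
apply/group_setP; split=> [|u v]; first by rewrite inE mx1 scalar_mx_is_scalar.
rewrite !inE mxM => /is_scalar_mxP[a ->] /is_scalar_mxP[b ->].
by rewrite -scalar_mxM scalar_mx_is_scalar.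
Qed.
Canonical scalars_group := Group scalars_group_set.

Lemma scalarsP u : reflect
    [/\ mx u 0%R 1%R = 0%R, mx u 1%R 0%R = 0%R & mx u 1%R 1%R = mx u 0%R 0%R]
  (u \in scalars).
Proof.
rewrite inE; apply: (iffP is_scalar_mxP) => [[a ->] | [u01 u10 u11]].
  by rewrite !mxE.
exists (mx u 0 0)%R; apply/matrixP.
move=> i j; rewrite mxE.
by case: (ord2_cases i) => ->; case: (ord2_cases j) => ->.
Qed.

Lemma scalars_center : scalars \subset 'Z('GL_2[F]).
Proof.
apply/subsetP=> u; rewrite inE => /is_scalar_mxP[a defu].
apply/centerP; split=> [|v _]; first by rewrite inE.
by apply: mx_inj; rewrite !mxM defu scalar_mxC.
Qed.

Lemma card_scalars : #|scalars| = #|F|.-1.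
Proof.
rewrite -(cardC1 (0%R : F)).
have inj : {in scalars &, injective (fun u => mx u 0%R 0%R)}.
  move=> u v /scalarsP[u01 u10 u11] /scalarsP[v01 v10 v11] e.
  by apply: GL2_ext; rewrite ?v01 ?v10 ?v11 ?u01 ?u10 ?u11.
rewrite -(card_in_imset inj); apply: eq_card => a; rewrite !inE.
apply/imsetP/idP=> [[u /scalarsP[u01 _ u11] ->] | nza].
  by have:= GL2_det u; rewrite u01 u11 mul0r subr0 mulf_eq0 orbb.
have [|e00 e01 e10 e11] := @gl2E a 0%R 0%R a.
  by rewrite mul0r subr0 mulf_neq0.
by exists (gl2 a 0 0 a)%R => //; apply/scalarsP; rewrite e11.
Qed.

Lemma scalars_cyclic : cyclic scalars.
Proof.
apply: (@field_mul_group_cyclic _ _ _ (fun u => mx u 0%R 0%R)) => [u v | u].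
  by move=> /scalarsP[u01 _ _] _; rewrite GL2_mulE u01 mul0r addr0.
move=> /scalarsP[u01 u10 u11]; split=> [u00 | ->]; last by rewrite mx1 mxE.
by apply: GL2_ext; rewrite ?u01 ?u10 ?u11 ?u00 mx1 mxE.
Qed.

Lemma det_mx_unit u : (\det (mx u))%R \is a GRing.unit.
Proof. by rewrite unitfE; exact: (GL_det u). Qed.

Definition det_unit u : {unit F} := FinRing.Unit (det_mx_unit u).

Lemma det_unitM : {in 'GL_2[F] &, {morph det_unit : u v / u * v}}.
Proof. by move=> u v _ _; apply: val_inj; exact: (det_mulmx (mx u) (mx v)). Qed.

Canonical det_unit_morphism := Morphism det_unitM.

Lemma ker_det_unit : 'ker det_unit = SLgroup 2 F.
Proof. by apply/setP=> u; rewrite !inE -val_eqE. Qed.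

Lemma im_det_unit : det_unit @* 'GL_2[F] = setT.
Proof.
apply/setP=> x; rewrite in_setT; apply/morphimP.
have nzx : val x != 0%R by rewrite -unitfE; case: (x).
have [|e00 e01 e10 e11] := @gl2E (val x) 0%R 0%R 1%R.
  by rewrite mul0r subr0 mulr1.
exists (gl2 (val x) 0 0 1)%R; rewrite ?inE //.
by apply: val_inj; rewrite /= det_mx2 e00 e01 e10 e11 mul0r subr0 mulr1.
Qed.

Lemma card_SL2 : #|SLgroup 2 F| = (#|F| * #|F|.-1 * #|F|.+1)%N.
Proof.
have: #|'GL_2[F]| = (#|SLgroup 2 F| * #|[set: {unit F}]|)%N.
  rewrite -ker_det_unit -(@card_morphpre _ _ _ _ [set: {unit F}]%G);
    last by rewrite im_det_unit.
  by apply: eq_card => u; rewrite !inE.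
rewrite card_finField_unit card_GL_2.
have: 0 < #|F|.-1 by rewrite -subn1 subn_gt0 finNzRing_gt1.
by move=> q1 e; apply/eqP; rewrite -(eqn_pmul2r q1) -e; apply/eqP; ring.
Qed.

(** This is a Borel subgroup: the stabiliser of the line spanned by the first basis row vector. *)
Lemma lower_group_set : group_set [set u | mx u 0%R 1%R == 0%R].
Proof.
apply/group_setP; split=> [|u v]; first by rewrite inE mx1 mxE.
by rewrite !inE GL2_mulE => /eqP-> /eqP->; rewrite mul0r mulr0 addr0.
Qed.
Canonical lower_group := Group lower_group_set.

Lemma card_lower_SL : #|lower_group :&: SLgroup 2 F| = (#|F| * #|F|.-1)%N.
Proof.
rewrite -(cardC1 (0%R : F)).
have eqL : lower_group :&: SLgroup 2 F =
    [set u | (mx u 0%R 1%R == 0%R) && (mx u 0 0 * mx u 1 1 == 1)%R].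
  apply/setP=> u; rewrite !inE -/(mx u) det_mx2.
  by case: eqP => //= ->; rewrite mul0r subr0.
rewrite eqL (card_lower_triangular (fun a d => a * d == 1)%R); congr (_ * _)%N.
have inj : injective (fun a : F => (a, a^-1)%R) by move=> a b [].
rewrite -(card_imset _ inj); apply: eq_card => -[a d]; rewrite !inE /=.
apply/and3P/imsetP=> [[nza nzd /eqP ad1] | [b]].
  by exists a; rewrite ?inE // -[(a^-1)%R]mulr1 -ad1 mulKf.
by rewrite !inE => nzb [-> ->]; rewrite invr_eq0 mulfV.
Qed.

(** By Cayley-Hamilton with determinant 1 and [u * u = 1], the trace times [u] is the scalar 2; as 2
    is nonzero, so is the trace, and [u] is scalar. *)
Lemma SL2_involution u :
  (2%:R != 0 :> F)%R -> u \in SLgroup 2 F -> #[u] = 2 -> u \in scalars.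
Proof.
move=> nz2 SLu ou; have u2 := mulg_order2 ou.
have det1 : (mx u 0 0 * mx u 1 1 - mx u 0 1 * mx u 1 0 = 1)%R.
  by apply/eqP; rewrite -det_mx2; move: SLu; rewrite inE.
have ent i j : (mx u i 0 * mx u 0 j + mx u i 1 * mx u 1 j = (i == j)%:R)%R.
  by rewrite -GL2_mulE u2 mx1 mxE.
have:= (ent 0 0, ent 0 1, ent 1 0, ent 1 1)%R; rewrite !eqxx /=.
set a := mx u 0%R 0%R; set b := mx u 0%R 1%R; set c := mx u 1%R 0%R.
set d := mx u 1%R 1%R in det1 * => -[[[e00 e01] e10] e11].
have ta : ((a + d) * a = 2%:R)%R.
  transitivity ((a * a + b * c) + (a * d - b * c))%R; first by ring.
  by rewrite e00 det1.
have td : ((a + d) * d = 2%:R)%R.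
  transitivity ((c * b + d * d) + (a * d - b * c))%R; first by ring.
  by rewrite e11 det1.
have nzt : (a + d != 0)%R by apply: contraNneq nz2 => t0; rewrite -ta t0 mul0r.
apply/scalarsP; split; apply: (mulfI nzt); rewrite ?mulr0.
- by rewrite -[RHS]e01 -/b; ring.
- by rewrite -[RHS]e10 -/c; ring.
- by rewrite td ta.
Qed.

(** A nontrivial [p]-element [u] of the Borel subgroup is unipotent and fixes only one line, so [g]
    has to preserve that line. *)
Lemma lower_TI p u g : p \in [pchar F]%R ->
    u \in lower_group :&: SLgroup 2 F ->
    u \in (lower_group :&: SLgroup 2 F) :^ g ->
    p.-elt u -> u != 1 -> g \in SLgroup 2 F ->
  g \in lower_group :&: SLgroup 2 F.
Proof.
move=> pF /setIP[Lu SLu] /mem_conjg_witness[v /setIP[Lv _] eq_gu] pu ntu SLg.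
rewrite inE SLg andbT inE; move: Lu Lv; rewrite !inE => /eqP u01 /eqP v01.
have powu n : (mx (u ^+ n)%g 0 0 = mx u 0 0 ^+ n)%R.
  elim: n => [|n IHn]; first by rewrite mx1 mxE.
  by rewrite expgS GL2_mulE u01 mul0r addr0 IHn exprS.
have u00 : mx u 0%R 0%R = 1%R.
  (* The order of [u] is a power of the characteristic, so by Frobenius the corresponding power of
     [mx u 0 0 - 1] is [1 - 1]. *)
  have pn : [pchar F]%R.-nat #[u] by rewrite (eq_pnat _ (pcharf_eq pF)).
  apply/eqP; rewrite -subr_eq0; have: ((mx u 0 0 - 1) ^+ #[u] == 0)%R.
    rewrite exprDn_pchar // exprNn_pchar // -powu expg_order mx1 mxE.
    by rewrite expr1n subrr.
  by rewrite expf_eq0 => /andP[].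
have u11 : mx u 1%R 1%R = 1%R.
  by move: SLu; rewrite inE -/(mx u) det_mx2 u00 u01 mul0r subr0 mul1r => /eqP.
have nzc : mx u 1%R 0%R != 0%R.
  apply: contraNneq ntu => u10; apply/eqP/GL2_ext;
  by rewrite ?u00 ?u01 ?u10 ?u11 mx1 mxE.
apply: contraR nzc => nzg.
(* If [mx g 0 1] is nonzero, entry (0, 1) forces [mx v 0 0 = 1], and then entry (0, 0) forces
   [mx u 1 0 = 0]. *)
have vg i j : mx (g * u) i j = mx (v * g) i j by rewrite eq_gu.
move: (vg 0 1)%R (vg 0 0)%R; rewrite !GL2_mulE v01 u01 u00 u11.
rewrite !mul0r !mulr1 mulr0 !addr0 add0r => e1.
have -> : mx v 0%R 0%R = 1%R by apply: (mulIf nzg); rewrite -e1 mul1r.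
by rewrite mul1r => /eqP; rewrite addrC -subr_eq0 addrK mulf_eq0 (negPf nzg).
Qed.

End GL2.

(** * Index bounds for subgroups without the scalar -1 *)

Section IndexBound.
Variables (F : finFieldType) (p k : nat).
Hypotheses (p_pr : prime p) (k_gt0 : 0 < k) (cardF : #|F| = (p ^ k)%N).
Hypothesis oddF : odd #|F|.

(** [odd_subgroup_bound] is applied to the Borel subgroup, of index [q + 1] and order [q (q - 1)].
    There [c] is odd and prime to [p], so it divides the odd part of [q - 1]. *)
Lemma odd_SL2_index (H : {group {'GL_2[F]}}) :
    H \subset SLgroup 2 F -> odd #|H| ->
  #|F|.+1 * (#|F|.-1)`_2 <= #|SLgroup 2 F : H|.
Proof.
move=> sH oddH; have q1 : 0 < #|F|.-1 by rewrite -subn1 subn_gt0 finNzRing_gt1.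
have q0 : 0 < #|F| by case: #|F| q1.
set B := (lower_group F :&: SLgroup 2 F)%G.
have iB : #|SLgroup 2 F : B| = #|F|.+1.
  have:= Lagrange (subsetIr (lower_group F) (SLgroup 2 F)).
  rewrite card_lower_SL card_SL2 => /eqP; rewrite eqn_pmul2l ?muln_gt0 ?q0 //.
  by move/eqP.
have sB := subsetIr (lower_group F) (SLgroup 2 F).
have [||c [dvc npc oddc leH]] := odd_subgroup_bound sB sH _ oddH p_pr.
- by rewrite iB /= negbK.
- move=> u g Bu Bgu pu ntu SLg; apply: (lower_TI _ Bu Bgu pu ntu SLg).
  exact: card_finPcharP cardF p_pr.
have lec : c <= (#|F|.-1)`_2^'.
  have <- : (c`_2^')%N = c by rewrite part_pnat_id // -odd_2'nat.
  rewrite dvdn_leq ?part_gt0 // partn_dvd //.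
  rewrite -(@Gauss_dvdr c #|F|) -?card_lower_SL // cardF coprimeXr //.
  by rewrite coprime_sym prime_coprime.
have q2 := partnC 2 q1.
have c0 : 0 < #|F| * (#|F|.-1)`_2^' by rewrite muln_gt0 q0 part_gt0.
have eqSL : (#|F| * (#|F|.-1)`_2^' * (#|F|.+1 * (#|F|.-1)`_2) =
             #|SLgroup 2 F|)%N.
  by rewrite card_SL2 -[in RHS]q2; ring.
rewrite -(leq_pmul2l c0) eqSL -(Lagrange sH) leq_mul2r; apply/orP; right.
by apply: leq_trans leH _; rewrite iB /= leq_mul2l lec orbT.
Qed.

(** An involution of [SL_2] in [K] would be scalar, and the cyclic group of scalars has only one
    subgroup of order 2, so [z] would be in [K]. Hence [K] meets [SL_2] in odd order. *)
Lemma SL2_index (K : {group {'GL_2[F]}}) z :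
    z \in scalars F -> #[z] = 2 -> z \notin K ->
  #|F|.+1 * (#|F|.-1)`_2 <= #|SLgroup 2 F : K|.
Proof.
move=> Zz oz K'z; have odd_KSL : odd #|SLgroup 2 F :&: K|.
  apply: contraR K'z; rewrite -dvdn2.
  case/(Cauchy (isT : prime 2)) => x /setIP[SLx Kx] ox.
  suff /eqP eq_zx : <[z]> == <[x]> by rewrite -cycle_subG eq_zx cycle_subG.
  have Zx : x \in scalars F.
    apply: SL2_involution SLx ox.
    rewrite -(dvdn_pcharf (card_finPcharP cardF p_pr)).
    apply: contraL oddF => p2; rewrite cardF.
    by have /eqP-> : p == 2; rewrite ?oddX ?(gtn_eqF k_gt0) // -dvdn_prime2.
  by rewrite (eq_subG_cyclic (scalars_cyclic F)) ?cycle_subG // -!orderE oz ox.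
by rewrite -indexgI odd_SL2_index ?subsetIl.
Qed.

(** The cosets of [K] with a representative in [SL_2] are among all its cosets in [GL_2]. *)
Lemma GL2_index (K : {group {'GL_2[F]}}) z :
    z \in scalars F -> #[z] = 2 -> z \notin K ->
  #|F|.+1 * (#|F|.-1)`_2 <= #|'GL_2[F] : K|.
Proof.
move=> Zz oz K'z; apply: leq_trans (SL2_index Zz oz K'z) _.
by rewrite subset_leq_card // imsetS // subsetT.
Qed.

End IndexBound.

(** * Lower bounds for the minimal degrees *)

Section MinimalDegree.
Variables (F : finFieldType) (p k : nat).
Hypotheses (p_pr : prime p) (k_gt0 : 0 < k) (cardF : #|F| = (p ^ k)%N).
Hypothesis oddF : odd #|F|.

Local Notation n := (#|F|.-1).
Local Notation A := (#|F|.+1 * n`_2)%N.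

Let n_gt0 : 0 < n. Proof. by rewrite -subn1 subn_gt0 finNzRing_gt1. Qed.
Let even_n : ~~ odd n.
Proof. by move: oddF n_gt0; case: #|F| => //= m; rewrite negbK. Qed.

Lemma scalars_SL2 (z : {'GL_2[F]}) :
  z \in scalars F -> #[z] = 2 -> z \in SLgroup 2 F.
Proof.
move=> /scalarsP[z01 z10 z11] oz.
rewrite inE -/(mx z) det_mx2 z01 z11 mul0r subr0.
have: (mx (z * z)%g 0 0 = 1)%R by rewrite (mulg_order2 oz) mx1 mxE.
by rewrite GL2_mulE z01 mul0r addr0 => ->.
Qed.

Lemma SL2_degree_ge m : embeds_in_Sym (SLgroup_group 2 F) m -> A <= m.
Proof.
move=> emb; have [z Zz oz] : {z | z \in scalars F & #[z] = 2}.
  by apply: (Cauchy (isT : prime 2)); rewrite card_scalars dvdn2.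
have:= @sum_weights_le_degree _ _ m unit [:: tt] (fun=> z) (fun=> A) emb.
rewrite big_seq1; apply=> [_ _ | H sH].
  split; last by rewrite -order_eq1 oz.
  have /centerP[_ cz] := subsetP (scalars_center F) z Zz.
  apply/centerP; split=> [|u _]; first exact: scalars_SL2.
  by apply: cz; rewrite inE.
rewrite big_mkcond big_seq1; case: ifP => // H'z.
exact: (SL2_index p_pr k_gt0 cardF oddF Zz oz H'z).
Qed.

(** For each prime [l] dividing [q - 1], a scalar of order [l] gets as weight the [l]-part of
    [q - 1] if [l] is odd, and [A] if [l = 2]. *)
Lemma GL2_degree_ge m : embeds_in_Sym 'GL_2[F]%G m -> A + T2 n <= m.
Proof.
move=> emb; pose w l := (if odd l then l ^ logn l n else A)%N.
(* The default 1 is never reached for [l] in [primes n], by Cauchy's theorem. *)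
pose z l : {'GL_2[F]} := odflt 1 [pick x in scalars F | #[x] == l].
have zP l : l \in primes n -> z l \in scalars F /\ #[z l] = l.
  rewrite mem_primes => /and3P[l_pr _].
  rewrite -(card_scalars F) => /(Cauchy l_pr)[x Zx ox].
  rewrite /z; case: pickP => [y /andP[Zy /eqP oy] | /(_ x)] //=.
  by rewrite Zx ox eqxx.
have -> : (A + T2 n = \sum_(l <- primes n) w l)%N.
  rewrite (bigID odd) /= addnC; congr addn.
    by apply: eq_bigr => l odd_l; rewrite /w odd_l.
  by rewrite (big_even_primes _ xpredT).
have w_gt1 l : l \in primes n -> 1 < w l.
  rewrite /w -logn_gt0 => l_gt0; case: ifP => odd_l.
    rewrite -(exp1n (logn l n)) ltn_exp2r //.
    by case: l l_gt0 odd_l => [|[|l]] //.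
  apply: leq_trans (leq_pmulr _ (part_gt0 _ _)).
  by move: n_gt0; case: #|F|.
apply: (sum_weights_le_degree (z := z) emb) => [l l_n | H _].
  have [Zz oz] := zP l l_n; split; first exact: (subsetP (scalars_center F)).
  by rewrite -order_eq1 oz; apply: contraTneq l_n => ->; rewrite mem_primes.
pose pi := [pred l | odd l & z l \notin H].
have pi'HZ : pi^'.-group (H :&: scalars F).
  apply/pgroupP=> l l_pr /(Cauchy l_pr)[x /setIP[Hx Zx] ox].
  rewrite !inE negb_and negbK; apply/orP; right.
  have [|Zz oz] := zP l.
    by rewrite mem_primes l_pr n_gt0 -(card_scalars F) -ox order_dvdG.
  suff /eqP eq_zx : <[z l]> == <[x]> by rewrite -cycle_subG eq_zx cycle_subG.
  by rewrite (eq_subG_cyclic (scalars_cyclic F)) ?cycle_subG // -!orderE oz ox.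
(* The index is now [#|GL_2 : K|] times the [pi]-part of [q - 1]. The second factor is the product
   of the odd weights; the first bounds the weight of 2, as [K] contains -1 only if [H] does. *)
have [K [-> KH]] := index_mul_central_Hall (scalars_center F) (subsetT H) pi'HZ.
rewrite card_scalars big_seq_cond.
apply: (leq_trans (sum_le_prod _ _)) => [l /andP[/w_gt1] // |].
rewrite -big_seq_cond (bigID odd) /= big_even_primes // mulnC.
rewrite (partn_prod_primes pi n_gt0); apply: leq_mul.
  case: ifP => // H'z2.
  have [|Zz oz] := zP 2; first by rewrite mem_primes n_gt0 dvdn2.
  apply: (GL2_index p_pr k_gt0 cardF oddF Zz oz).
  apply: contra H'z2 => Kz; apply: KH => //.
  by rewrite /p_elt oz pnatE.
rewrite leq_eqVlt; apply/orP; left; apply/eqP.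
rewrite (eq_bigl (fun l => l \in pi)) => [|l]; last by rewrite !inE andbC.
by apply: eq_bigr => l /andP[odd_l _]; rewrite /w odd_l.
Qed.

(** * Upper bounds: faithful actions on coset spaces *)

Local Notation m2 := (n`_2^')%N.

(* Matrices act on row vectors, from the right: this is the stabiliser of the
   class of the first basis vector modulo scalars of odd order. *)
Lemma line_stab_group_set : group_set
  [set u : {'GL_2[F]} | (mx u 0 1 == 0)%R && (mx u 0 0 ^+ m2 == 1)%R].
Proof.
apply/group_setP; split=> [|u v]; first by rewrite inE mx1 !mxE expr1n !eqxx.
rewrite !inE !GL2_mulE => /andP[/eqP-> /eqP u00] /andP[/eqP-> /eqP v00].
by rewrite !mul0r !mulr0 !addr0 exprMn u00 v00 mulr1 !eqxx.
Qed.
Let lineStab := Group line_stab_group_set.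

(** An upper bound on the index needs only enough solutions of [a ^+ m2 = 1]; the Hall [2']-subgroup
    of the unit group provides [m2] of them. *)
Lemma index_line_stab : #|'GL_2[F] : lineStab| <= A.
Proof.
have leH0 : #|F| * (m2 * n) <= #|lineStab|.
  rewrite /= (card_lower_triangular (fun a _ => a ^+ m2 == 1)%R) leq_mul2l.
  apply/orP; right.
  have [U hallU] : exists U : {group {unit F}}, 2^'.-Hall([set: {unit F}]) U.
    by apply/Hall_exists/abelian_sol/cyclic_abelian/field_unit_group_cyclic.
  have cardU : #|U| = m2 by rewrite (card_Hall hallU) card_finField_unit.
  rewrite -{1}cardU -[X in (_ * X)%N](cardC1 (0%R : F)).
  rewrite -(card_imset _ val_inj) -cardX.
  apply: subset_leq_card; apply/subsetP=> -[a d]; rewrite !inE /=.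
  case/andP=> /imsetP[y Uy ->] ->; rewrite andTb -unitfE (valP y) /=.
  move/(congr1 val): (expg_cardG Uy).
  by rewrite FinRing.val_unitX cardU => /eqP.
have n2 : (n`_2 * m2)%N = n := partnC 2 n_gt0.
have c0 : 0 < #|F| * (m2 * n).
  by rewrite !muln_gt0 part_gt0 n_gt0 ltnW ?finNzRing_gt1.
rewrite -(leq_pmul2l c0).
have -> : (#|F| * (m2 * n) * A = #|'GL_2[F]|)%N.
  by rewrite card_GL_2; move: (n`_2)%N m2 n2 => t u <-; ring.
by rewrite -(Lagrange (subsetT lineStab)) leq_mul2r leH0 orbT.
Qed.

Let Hdet (l : nat) := (det_unit_morphism F @*^-1 'O_(l^')([set: {unit F}]))%G.

Lemma index_det_pcore l : #|'GL_2[F] : Hdet l| = (l ^ logn l n)%N.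
Proof.
have -> : 'GL_2[F] = det_unit_morphism F @*^-1 setT.
  by apply/setP=> u; rewrite !inE.
rewrite index_morphpre ?im_det_unit //.
have hallO : (l^').-Hall([set: {unit F}]) 'O_(l^')([set: {unit F}]).
  apply/nilpotent_pcore_Hall/abelian_nil/cyclic_abelian.
  exact: field_unit_group_cyclic.
rewrite -divgS ?subsetT // (card_Hall hallO) card_finField_unit -p_part.
by rewrite -{1}(partnC l n_gt0) mulnK ?part_gt0.
Qed.

(** By the first hypothesis [x] is a scalar [y] of odd order; by the second, its determinant
    [y ^+ 2] has order prime to every odd [l] dividing [q - 1], so [y = 1]. Conjugating by [SL_2]
    alone lets the lemma serve both groups. *)
Lemma line_stab_det_core1 (x : {'GL_2[F]}) :
    (forall g, g \in SLgroup 2 F -> x \in lineStab :^ g) ->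
    (forall l, l \in primes n -> odd l -> x \in Hdet l) ->
  x = 1.
Proof.
move=> core_x det_x.
(* The first row of [g] is an eigenvector of [x], with an eigenvalue of odd order. The first rows
   (1, 0), (0, 1) and (1, 1) below make [x] scalar. *)
have row g : g \in SLgroup 2 F -> exists v, [/\ (mx v 0 0 ^+ m2 = 1)%R &
    forall j, (mx v 0 0 * mx g 0 j =
               mx g 0 0 * mx x 0 j + mx g 0 1 * mx x 1 j)%R].
  move=> /core_x/mem_conjg_witness[v].
  rewrite inE => /andP[/eqP v01 /eqP v00] eqgx; exists v; split=> // j.
  by rewrite -GL2_mulE eqgx GL2_mulE v01 mul0r addr0.
have SL1 a b c d : (a * d - b * c = 1 :> F)%R -> gl2 a b c d \in SLgroup 2 F.
  move=> e; have [|e00 e01 e10 e11] := @gl2E F a b c d.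
    by rewrite e oner_neq0.
  by rewrite inE -/(mx _) det_mx2 e00 e01 e10 e11 e.
have [x01 x00m] : (mx x 0 1 = 0)%R /\ (mx x 0 0 ^+ m2 = 1)%R.
  have [v [vm rowv]] := row _ (group1 (SLgroup_group 2 F)).
  have := rowv 1%R; have := rowv 0%R; rewrite mx1 !mxE /= !mulr1n !mulr0n.
  by rewrite !mulr1 !mulr0 !mul1r !mul0r !addr0 => <- <-.
have x10 : (mx x 1 0 = 0)%R.
  have e : (0 * 0 - 1 * -1 = 1 :> F)%R by rewrite mul0r sub0r mul1r opprK.
  have [v [_ /(_ 0%R)]] := row _ (SL1 _ _ _ _ e).
  have [|-> -> _ _] := @gl2E F 0%R 1%R (-1)%R 0%R; first by rewrite e oner_neq0.
  by rewrite mulr0 mul0r add0r mul1r.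
have x11 : (mx x 1 1 = mx x 0 0)%R.
  have e : (1 * 1 - 1 * 0 = 1 :> F)%R by rewrite mulr0 subr0 mulr1.
  have [v [_ rowv]] := row _ (SL1 _ _ _ _ e).
  have [|g00 g01 _ _] := @gl2E F 1%R 1%R 0%R 1%R; first by rewrite e oner_neq0.
  have := rowv 1%R; have := rowv 0%R.
  by rewrite g00 g01 x01 x10 !mulr1 !mul1r addr0 add0r => ->.
have x00U : mx x 0%R 0%R \is a GRing.unit.
  rewrite unitfE; apply: contra_eq_neq x00m => ->.
  by rewrite expr0n gtn_eqF ?part_gt0 // eq_sym oner_neq0.
pose y := FinRing.Unit x00U.
have ym : y ^+ m2 = 1 by apply: val_inj; rewrite FinRing.val_unitX.
have y2 : det_unit x = y ^+ 2.
  by apply: val_inj; rewrite /= det_mx2 x01 x10 x11 mul0r subr0.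
suff /eqP y1 : y == 1.
  have x00 : (mx x 0 0 = 1)%R by have /(congr1 val) := y1.
  by apply: GL2_ext; rewrite mx1 ?x11 ?x00 ?x01 ?x10 mxE.
rewrite -order_eq1 eqn_leq order_gt0 andbT leqNgt.
apply/negP=> /pdivP[l l_pr l_y].
have l_m2 : l %| m2 by apply: dvdn_trans l_y _; rewrite order_dvdn ym.
have odd_y : odd #[y].
  apply: (dvdn_odd (_ : _ %| m2)); first by rewrite order_dvdn ym.
  by rewrite odd_2'nat part_pnat.
have odd_l : odd l := dvdn_odd l_y odd_y.
have l_n : l \in primes n.
  by rewrite mem_primes l_pr n_gt0 (dvdn_trans l_m2) ?dvdn_part.
(* As [y] has odd order, [y ^+ 2] has the same order, divisible by [l], although it lies in an
   [l']-group. *)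
have /morphpreP[_] := det_x l l_n odd_l; rewrite /= y2 => Oy2.
have := mem_p_elt (pcore_pgroup _ _) Oy2; rewrite /p_elt p'natE //.
by rewrite orderXgcd (eqP (_ : coprime _ 2)) ?divn1 ?l_y // coprimen2.
Qed.

(** One coset space is enough here, since the determinant conditions hold trivially. *)
Lemma SL2_embeds : embeds_in_Sym (SLgroup_group 2 F) #|SLgroup 2 F : lineStab|.
Proof.
have := @embeds_sum_index _ (SLgroup_group 2 F) unit (fun=> lineStab).
rewrite (big_pred1 tt) => [|[]//]; apply=> x SLx core_x.
apply: line_stab_det_core1 => [g /(core_x tt) //|l _ _].
have x1 : det_unit x = 1 by apply: val_inj; apply/eqP; rewrite inE in SLx.
by apply/morphpreP; rewrite /= x1 group1 inE.
Qed.

Lemma GL2_embeds : exists2 m, embeds_in_Sym 'GL_2[F]%G m & m <= A + T2 n.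
Proof.
pose ls := [seq l <- primes n | odd l].
(* Index 0 is the action on vectors modulo odd scalars; index [j + 1] is the determinant action for
   the odd prime at position [j]. *)
pose H (i : 'I_(size ls).+1) :=
  if nat_of_ord i is j.+1 then Hdet (nth 0 ls j) else lineStab.
exists (\sum_i #|'GL_2[F] : H i|)%N.
  apply: embeds_sum_index => x _ core_x.
  apply: line_stab_det_core1 => [g _|l l_n odd_l].
    by apply: (core_x ord0); rewrite inE.
  have lls : l \in ls by rewrite mem_filter odd_l.
  pose i := Ordinal (etrans (index_mem l ls) lls).
  have := core_x (lift ord0 i) 1 (group1 _).
  by rewrite /H lift0 /= nth_index // conjsg1.
rewrite big_ord_recl leq_add ?index_line_stab //.
rewrite /T2 -big_filter (big_nth 0) big_mkord.
by apply: leq_sum => i _; rewrite /H lift0 index_det_pcore.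
Qed.

End MinimalDegree.

Theorem theorem5p1 (q : nat) (hq3 : (3 <= q)%N) (hqodd : odd q)
    (hqpp : prime_power q) (F : finFieldType) (hF : #|F| = q) :
  min_perm_degree 'GL_2[F]%G =
    (min_perm_degree (SLgroup_group 2 F) + T2 (q - 1))%N /\
  (min_perm_degree (SLgroup_group 2 F) + T2 (q - 1))%N =
    ((q + 1) * (q - 1)`_2 + T2 (q - 1))%N.
Proof.
case: hqpp => p [k [p_pr k_gt0 def_q]]; rewrite def_q in hF.
have oddF : odd #|F| by rewrite hF -def_q.
rewrite def_q -hF addn1 subn1.
have degSL : min_perm_degree (SLgroup_group 2 F) = (#|F|.+1 * (#|F|.-1)`_2)%N.
  apply/eqP; rewrite eqn_leq (min_perm_degree_le (SL2_embeds F)) /=.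
    exact: (SL2_degree_ge p_pr k_gt0 hF oddF (min_perm_degreeP _)).
  apply: leq_trans (index_line_stab F).
  by rewrite subset_leq_card // imsetS // subsetT.
have [m GLm le_m] := GL2_embeds F.
split; last by rewrite degSL.
apply/eqP; rewrite degSL eqn_leq (min_perm_degree_le GLm le_m) /=.
exact: (GL2_degree_ge p_pr k_gt0 hF oddF (min_perm_degreeP _)).
Qed.
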